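(* Let $H$ be a Hamiltonian on $n$ qubits placed on a $d$-dimensional lattice, with $\kappa$-local interactions of strength at most $J>0$, normalized such that $\kappa Jn\le\|H\|\le2\kappa Jn$. Let $\Phi(\rho)$ be the output, on an $n$-qubit input state $\rho$, of a noisy quantum circuit on $n$ qubits consisting of $D$ layers of unitaries interspersed with local depolarizing channels of depolarizing rate $p\in(0,1]$, and let $\epsilon>0$. If $D\ge D_{\max}$ with $$D_{\max}=\frac{\log\left(20e\,d^{\kappa}\epsilon^{-1}\right)}{2p},$$ then there is a Gibbs state $\tilde\sigma=e^{-\beta H}/\mathrm{tr}(e^{-\beta H})$, $\beta\ge0$, satisfying $$\mathrm{tr}\left(H(\tilde\sigma-\Phi(\rho))\right)\le2\kappa Jn\,\epsilon,$$ and whose energy with respect to $H$ can be computed in quasi-polynomial time, in the sense that $\beta\le(5e\kappa d^{\kappa}J)^{-1}$.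
   Context: The circuit channel is $\Phi=T\circ\mathcal U_D\circ\cdots\circ T\circ\mathcal U_1$, where each $\mathcal U_t$ is a unitary channel on $n$ qubits and $T$ is the $n$-fold tensor power of the one-qubit depolarizing channel $\omega\mapsto(1-p)\omega+p\,\mathrm{tr}(\omega)I/2$. ''$\kappa$-local interactions of strength at most $J$'' means that $H$ is a sum of Hermitian terms, each acting on at most $\kappa$ lattice sites and of operator norm at most $J$. $\|\cdot\|$ is the operator norm, $\log$ the natural logarithm, $e=\exp(1)$. Computability convention: the paper takes as given (from the literature) that for inverse temperatures $\beta\le(5e\kappa d^\kappa J)^{-1}$ the partition function $\mathrm{tr}(e^{-\beta H})$ of such $H$ can be approximated up to multiplicative error $\delta$ in time $O(n^{\log(n\delta^{-1})})$; ''can be computed in quasi-polynomial time'' refers to this range of $\beta$. The following known contraction estimate is part of the setting: with $\sigma=I/2^n$, $D(T(\omega)\|\sigma)\le(1-p)^2D(\omega\|\sigma)$ for all states $\omega$, where $D(\cdot\|\cdot)$ is the quantum relative entropy. *)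

(* Defs.v *)
From HB Require Import structures.
From mathcomp Require Import all_boot all_order all_algebra.
From mathcomp Require Import finmap complex.
From mathcomp Require Import all_classical all_reals ereal sequences exp.

Set Implicit Arguments.
Unset Strict Implicit.
Unset Printing Implicit Defensive.

Import Order.TTheory GRing.Theory Num.Theory.

Local Open Scope ring_scope.
Local Open Scope complex_scope.
Local Open Scope sesquilinear_scope.

Section Operators.
Variables (R : realType) (m : nat).
Local Notation C := R[i].
Implicit Types A w s H : 'M[C]_m.

Definition l2norm (v : 'cV[C]_m) : R :=
  Num.sqrt (\sum_(i < m) ComplexField.Normc.normc (v i 0) ^+ 2).

Definition opnorm A : R :=
  sup [set r | exists2 v : 'cV[C]_m, l2norm v <= 1 & r = l2norm (A *m v)]%classic.

Definition density w : Prop :=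
  [/\ w \is hermsymmx,
      forall v : 'cV[C]_m, 0 <= (v ^t* *m w *m v) 0 0
    & \tr w = 1].

(* Functional calculus of Hermitian matrices: an orthonormal eigenbasis is kept
   and every eigenvalue x is replaced by f x. By [hfun_diag] the result does
   not depend on the diagonalization chosen by [spectralmx]. *)
Definition hfun (f : R -> R) A : 'M[C]_m :=
  invmx (spectralmx A)
  *m diag_mx (map_mx (fun x => (f (complex.Re x))%:C) (spectral_diag A))
  *m spectralmx A.

Definition gibbs (beta : R) H : 'M[C]_m :=
  let E := hfun (@expR R) ((- beta)%:C *: H) in (\tr E)^-1 *: E.

(* D(w || s) = tr (w (log w - log s)) if supp w is contained in supp s, and +oo
   otherwise. For Hermitian matrices inclusion of the supports is inclusion of
   the row spaces; since [ln 0 = 0], [hfun (@ln R) w] is log w on supp w and 0 on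
   ker w, which implements 0 log 0 = 0. *)
Definition relent w s : \bar R :=
  if (w <= s)%MS
  then (complex.Re (\tr (w *m (hfun (@ln R) w - hfun (@ln R) s))))%:E
  else +oo%E.

Lemma hfun_diag (f : R -> R) (P : 'M[C]_m) (x : 'rV[R]_m) :
  P \is unitarymx ->
  hfun f (P ^t* *m diag_mx (map_mx (fun r => r%:C) x) *m P)
  = P ^t* *m diag_mx (map_mx (fun r => (f r)%:C) x) *m P.
Proof.
set d := map_mx (fun r => r%:C) x; set A := P ^t* *m diag_mx d *m P => Pu.
have An : A \is normalmx.
  apply/hermitian_normalmx/is_hermitianmxP; rewrite expr0 scale1r /A.
  rewrite !trmx_mul !map_mxM tr_diag_mx map_diag_mx trmxCK mulmxA.
  congr (_ *m diag_mx _ *m _); apply/rowP => j; rewrite !mxE.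
  by apply/esym/CrealP; rewrite complex_real.
have Qu := spectral_unitarymx A; have /orthomx_spectralP AE := An.
rewrite /hfun; move: Qu AE; set Q := spectralmx A; set e := spectral_diag A => Qu.
rewrite invmx_unitary // => AE.
set W := Q *m P ^t*.
have eW : diag_mx e *m W = W *m diag_mx d.
  have /(congr1 (fun X => Q *m X *m P ^t*)) := AE.
  rewrite /A !mulmxA (unitarymxP Qu) mul1mx => AE'.
  by rewrite /W -AE' -(mulmxA _ P) (unitarymxP Pu) mulmx1.
set fe := map_mx _ e; set fd := map_mx _ x.
have fW : diag_mx fe *m W = W *m diag_mx fd.
  apply/matrixP => i j; rewrite mul_diag_mx mul_mx_diag [in LHS]mxE [in RHS]mxE.
  have /matrixP/(_ i j) := eW.
  rewrite mul_diag_mx mul_mx_diag [in LHS]mxE [in RHS]mxE mulrC.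
  have [-> _|W0 /(mulfI W0) eE] := eqVneq (W i j) 0; first by rewrite mul0r mulr0.
  have -> : fe 0 i = (f (complex.Re (e 0 i)))%:C by rewrite mxE.
  have -> : fd 0 j = (f (x 0 j))%:C by rewrite mxE.
  have dE : d 0 j = (x 0 j)%:C by rewrite mxE.
  by rewrite mulrC eE dE.
have QtQ : Q ^t* *m Q = 1%:M.
  by rewrite -(invmx_unitary Qu) mulVmx // unitarymx_unit.
have PtP : P ^t* *m P = 1%:M.
  by rewrite -(invmx_unitary Pu) mulVmx // unitarymx_unit.
have PW : P ^t* = Q ^t* *m W by rewrite /W mulmxA QtQ mul1mx.
have WP : W *m P = Q by rewrite /W -mulmxA PtP mulmx1.
by rewrite PW -[Q ^t* *m W *m _]mulmxA -fW -[RHS]mulmxA -[in RHS](mulmxA _ W) WP !mulmxA.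
Qed.

End Operators.

Section Qubits.
Variable R : realType.
Local Notation C := R[i].

(* One qubit per element of V. The computational basis is indexed by the bit
   strings {ffun V -> 'I_2}, numbered through [enum_val]. *)
Definition qdim (V : finType) : nat := #|{ffun V -> 'I_2}|.

Definition bits (V : finType) (i : 'I_(qdim V)) : {ffun V -> 'I_2} := enum_val i.

Lemma qdimE n : qdim 'I_n = (2 ^ n)%N.
Proof. by rewrite /qdim card_ffun !card_ord. Qed.

Definition tensor (V : finType) (A : V -> 'M[C]_2) : 'M[C]_(qdim V) :=
  \matrix_(i, j) \prod_(k : V) A k (bits i k) (bits j k).

(* The tensor power of a linear map E on one-qubit operators, i.e. the linear
   map sending [tensor A] to [tensor (E \o A)]: each matrix unit |i><j| is the
   tensor product of the one-qubit matrix units |i_k><j_k|. *)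
Definition tensor_channel (V : finType) (E : 'M[C]_2 -> 'M[C]_2)
    (w : 'M[C]_(qdim V)) : 'M[C]_(qdim V) :=
  \sum_i \sum_j w i j *: tensor (fun k => E (delta_mx (bits i k) (bits j k))).

Definition depolarizing1 (p : R) (w : 'M[C]_2) : 'M[C]_2 :=
  (1 - p)%:C *: w + (p%:C * \tr w) *: (2^-1)%:M.

Definition depolarizing (V : finType) (p : R) : 'M[C]_(qdim V) -> 'M[C]_(qdim V) :=
  tensor_channel (depolarizing1 p).

Definition max_mixed (V : finType) : 'M[C]_(qdim V) := ((qdim V)%:R^-1)%:M.

Definition circuit (V : finType) (p : R) (Us : seq 'M[C]_(qdim V))
    (rho : 'M[C]_(qdim V)) : 'M[C]_(qdim V) :=
  foldl (fun w U => depolarizing p (U *m w *m U ^t*)) rho Us.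

Definition restrict_bits (V : finType) (S : {set V}) (x : {ffun V -> 'I_2}) :
  {ffun {k : V | k \in S} -> 'I_2} := [ffun k => x (val k)].

(* B (x) id, with B acting on the qubits of S and id on those outside S. *)
Definition extend_op (V : finType) (S : {set V})
    (B : 'M[C]_(qdim {k : V | k \in S})) : 'M[C]_(qdim V) :=
  \matrix_(i, j) (B (enum_rank (restrict_bits S (bits i)))
                    (enum_rank (restrict_bits S (bits j)))
    *+ [forall k, (k \notin S) ==> (bits i k == bits j k)]).

Definition acts_on (V : finType) (S : {set V}) (h : 'M[C]_(qdim V)) : Prop :=
  exists B : 'M[C]_(qdim {k : V | k \in S}), h = @extend_op V S B.

(* [pos k] is the site of the lattice Z^d carrying qubit k; S is the set of
   lattice sites on which a given term acts. *)
Definition local_hamiltonian (n d : nat) (pos : 'I_n -> 'rV[int]_d)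
    (kappa : nat) (J : R) (H : 'M[C]_(qdim 'I_n)) : Prop :=
  exists (N : nat) (h : 'I_N -> 'M[C]_(qdim 'I_n)),
    H = \sum_(a < N) h a /\
    forall a,
      [/\ h a \is hermsymmx,
          exists2 S : {fset 'rV[int]_d},
            (#|` S| <= kappa)%N & acts_on [set k | pos k \in S]%SET (h a)
        & opnorm (h a) <= J].

End Qubits.

Arguments max_mixed : clear implicits.

(* Main.v *)
(* For every state [w] and real [beta], Klein's inequality gives
   [beta * tr (H (gibbs beta H - w)) <= D(w || 1/2^n)]. Depolarizing layers
   preserve states and unitaries preserve [D(. || 1/2^n)], so the contraction
   estimate iterates to [D(circuit || 1/2^n) <= (1 - p)^(2 D) * ln (2^n)
   <= exp (- 2 p D) * n], and [beta = (5 e kappa d^kappa J)^-1] suffices. Locality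
   of [H] is needed only if [kappa = 0], where this [beta] is the junk value [0]
   but [H] is scalar. *)

Require Import Defs.
From HB Require Import structures.
From mathcomp Require Import all_boot all_order all_algebra.
From mathcomp Require Import finmap complex.
From mathcomp Require Import all_classical all_reals ereal sequences exp.
From mathcomp Require Import ring lra.

Set Implicit Arguments.
Unset Strict Implicit.
Unset Printing Implicit Defensive.

Import Order.TTheory GRing.Theory Num.Theory.

Local Open Scope ring_scope.
Local Open Scope complex_scope.
Local Open Scope sesquilinear_scope.

(** * Cyclicity of the trace and conjugation identities *)

Lemma trace_conj_mul (K : comPzRingType) (m : nat) (A A' D B B' E : 'M[K]_m) :
  \tr ((A' *m D *m A) *m (B' *m E *m B))
  = \tr ((D *m (A *m B')) *m (E *m (B *m A'))).
Proof. by rewrite -!mulmxA mxtrace_mulC !mulmxA. Qed.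

Lemma conj_mulmx (K : pzRingType) (m : nat) (P P' A B : 'M[K]_m) :
  P *m P' = 1%:M ->
  (P' *m A *m P) *m (P' *m B *m P) = P' *m (A *m B) *m P.
Proof. by move=> PP; rewrite !mulmxA -(mulmxA _ P P') PP mulmx1. Qed.

Lemma scale_conj_mulmx (K : comPzRingType) (m : nat) (c : K)
    (P P' A : 'M[K]_m) : c *: (P' *m A *m P) = P' *m (c *: A) *m P.
Proof. by rewrite scalemxAl scalemxAr. Qed.

(** * Spectral decompositions with real eigenvalues *)

Section Entropy.
Variables (R : realType) (m : nat).
Local Notation C := R[i].
Local Notation rdiag x := (diag_mx (map_mx (fun r => r%:C) x)).
Local Notation normc := ComplexField.Normc.normc.
Implicit Types (w H P Q W : 'M[C]_m) (x y : 'rV[R]_m).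

Lemma trmxC_mul (a b c : nat) (A : 'M[C]_(a, b)) (B : 'M[C]_(b, c)) :
  (A *m B)^t* = B^t* *m A^t*.
Proof. by rewrite trmx_mul map_mxM. Qed.

Lemma normc_sqr (z : C) : (normc z ^+ 2)%:C = z * z^*.
Proof. by rewrite -normCK rmorphXn. Qed.

Lemma unitarymxKV P : P \is unitarymx -> P^t* *m P = 1%:M.
Proof. by move=> Pu; rewrite -(invmx_unitary Pu) mulVmx ?unitarymx_unit. Qed.

Lemma unitary_row_sum W i : W \is unitarymx -> \sum_j normc (W i j) ^+ 2 = 1.
Proof.
move/unitarymxP/matrixP/(_ i i); rewrite !mxE eqxx => W1.
apply: complexI; rewrite raddf_sum -[RHS]W1 /=.
by apply: eq_bigr => j _; rewrite normc_sqr !mxE.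
Qed.

Lemma unitary_col_sum W j : W \is unitarymx -> \sum_i normc (W i j) ^+ 2 = 1.
Proof.
rewrite -trmx_unitary => /unitary_row_sum -/(_ j) <-.
by apply: eq_bigr => i _; rewrite mxE.
Qed.

(** The eigenvalues are delivered as a row over [R], the shape in which [hfun_diag] evaluates
    functions of the operator. *)
Lemma herm_spectral H : H \is hermsymmx ->
  exists P x, P \is unitarymx /\ H = P^t* *m rdiag x *m P.
Proof.
move=> Hh; have /hermitian_normalmx/orthomx_spectralP := Hh.
have := hermitian_spectral_diag_real Hh; have := spectral_unitarymx H.
move: (spectralmx H) (spectral_diag H) => P e Pu /mxOverP er.
have eE : map_mx (fun r => r%:C) (map_mx (@complex.Re R) e) = e.
  by apply/rowP => j; rewrite !mxE; have /RRe_real := er 0 j.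
rewrite (invmx_unitary Pu) -{1}eE => HE.
by exists P, (map_mx (@complex.Re R) e).
Qed.

Lemma trace_spectral P x : P \is unitarymx ->
  \tr (P^t* *m rdiag x *m P) = (\sum_i x 0 i)%:C.
Proof.
move=> Pu; rewrite mxtrace_mulC mulmxA (unitarymxP Pu) mul1mx mxtrace_diag.
by rewrite raddf_sum; apply: eq_bigr => i _; rewrite mxE.
Qed.

(** By cyclicity only the change of basis [P *m Q^t*] and its adjoint remain, so each pair of
    eigenvalues is weighted by the squared overlap of its eigenvectors. *)
Lemma trace_spectral_mul P Q x y :
  \tr ((P^t* *m rdiag x *m P) *m (Q^t* *m rdiag y *m Q))
  = (\sum_i \sum_j normc ((P *m Q^t*) i j) ^+ 2 * (x 0 i * y 0 j))%:C.
Proof.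
set W := P *m Q^t*.
rewrite trace_conj_mul -[X in _ *m (_ *m X)]trmxCK trmxC_mul trmxCK.
rewrite raddf_sum /=; apply: eq_bigr => i _.
rewrite mxE raddf_sum /=; apply: eq_bigr => j _.
rewrite mul_diag_mx mul_diag_mx [W^t*]lock !mxE -lock !mxE.
rewrite [RHS]rmorphM /= normc_sqr rmorphM /=.
by rewrite mulrACA mulrC.
Qed.

Lemma density_spectral w : density w ->
  exists P x, [/\ P \is unitarymx, w = P^t* *m rdiag x *m P,
    forall i, 0 <= x 0 i & \sum_i x 0 i = 1].
Proof.
case=> /herm_spectral[P [x [Pu wE]]] w_ge0 w1; exists P, x; split=> //.
  move=> i; rewrite -ler0c.
  (* The test vector is the [i]-th eigenvector, so the quadratic form reads off the [i]-th
     eigenvalue. *)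
  have := w_ge0 (P^t* *m delta_mx i 0); rewrite wE trmxC_mul trmxCK.
  rewrite !mulmxA !mulmxtVK //.
  have -> : (delta_mx i 0 : 'cV[C]_m)^t* = delta_mx 0 i.
    apply/matrixP => a b; rewrite !mxE andbC.
    by case: (_ && _); rewrite ?conjC1 ?conjC0.
  by rewrite -rowE -colE !mxE eqxx mulr1n.
by apply: complexI; rewrite -(trace_spectral x Pu) -wE w1.
Qed.

Lemma sum1_dim_gt0 x : \sum_i x 0 i = 1 -> (0 < m)%N.
Proof.
case: (posnP m) => // m0 /eqP; rewrite big1 ?(eq_sym 0) ?oner_eq0 // => i _.
by exfalso; have := leq_ltn_trans (leq0n i) (ltn_ord i); rewrite m0.
Qed.

(** * Entropy inequalities for eigenvalue distributions *)

Lemma xlnx_ge (a b : R) : 0 <= a -> 0 < b -> a - b <= a * (ln a - ln b).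
Proof.
rewrite le_eqVlt => /predU1P[<- b0|a0 b0].
  by rewrite mul0r sub0r oppr_le0 ltW.
(* This is [ln t <= t - 1] at [t = b / a]; multiplying by [a] gives the claim. *)
have : ln (b / a) <= b / a - 1.
  have := @le_ln1Dx R (b / a - 1); rewrite addrCA subrr addr0; apply.
  by rewrite ltrBDr addNr divr_gt0.
rewrite ln_div ?posrE // -(ler_pM2l a0) [leRHS]mulrBr mulrCA divff ?gt_eqF // !mulr1.
by rewrite -lerN2 opprB -mulrN opprB.
Qed.

(* Klein's inequality in the eigenbases: [W] is the change of basis and the
   [|W_ij|^2] form a doubly stochastic matrix. *)
Lemma klein W x y : W \is unitarymx ->
  (forall i, 0 <= x 0 i) -> (forall j, 0 < y 0 j) ->
  \sum_i x 0 i = \sum_j y 0 j ->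
  \sum_i \sum_j normc (W i j) ^+ 2 * (x 0 i * ln (y 0 j))
    <= \sum_i x 0 i * ln (x 0 i).
Proof.
move=> Wu x0 y0 xy.
(* Each row of weights sums to 1, so a sum over [i] spreads over the pairs [(i, j)]. *)
have rowE (f : R -> R) :
    \sum_i f (x 0 i) = \sum_i \sum_j normc (W i j) ^+ 2 * f (x 0 i).
  by apply: eq_bigr => i _; rewrite -mulr_suml unitary_row_sum // mul1r.
rewrite -subr_ge0 (rowE (fun a => a * ln a)) /= -sumrB.
(* Row and column sums together with the equal totals make this sum vanish. It then stands in for
   the lower bound 0, and [xlnx_ge] applies pair by pair. *)
have zE : \sum_i \sum_j normc (W i j) ^+ 2 * (x 0 i - y 0 j) = 0.
  rewrite (eq_bigr (fun i => \sum_j normc (W i j) ^+ 2 * x 0 i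
            - \sum_j normc (W i j) ^+ 2 * y 0 j)); last first.
    by move=> i _; rewrite -sumrB; apply: eq_bigr => j _; rewrite mulrBr.
  rewrite sumrB -(rowE id) xy exchange_big /= -sumrB big1 // => j _.
  by rewrite -mulr_suml unitary_col_sum // mul1r subrr.
rewrite -[leLHS]zE; apply: ler_sum => i _; rewrite -sumrB; apply: ler_sum => j _.
rewrite -!mulrBr; apply: ler_wpM2l; first exact: sqr_ge0.
exact: xlnx_ge.
Qed.

(** The classical form of Klein's inequality against the uniform distribution [1 / m]: no change of
    basis enters, and [xlnx_ge] is summed directly. *)
Lemma neg_entropy_ge x : (forall i, 0 <= x 0 i) -> \sum_i x 0 i = 1 ->
  - ln m%:R <= \sum_i x 0 i * ln (x 0 i).
Proof.
move=> x0 x1.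
have m0 : (0 < m%:R :> R) by rewrite ltr0n (sum1_dim_gt0 x1).
have V0 : 0 < (m%:R^-1 : R) by rewrite invr_gt0.
rewrite -lnV ?posrE // -[leLHS]mul1r -[X in X * _]x1 mulr_suml -subr_ge0 -sumrB.
have zE : \sum_i (x 0 i - m%:R^-1) = 0.
  by rewrite sumrB x1 sumr_const card_ord -[_^-1 *+ _]mulr_natl divff ?gt_eqF ?subrr.
by rewrite -[leLHS]zE; apply: ler_sum => i _; rewrite -mulrBr; apply: xlnx_ge.
Qed.

Lemma neg_entropy_le0 x : (forall i, 0 <= x 0 i) -> \sum_i x 0 i = 1 ->
  \sum_i x 0 i * ln (x 0 i) <= 0.
Proof.
move=> x0 x1; apply: sumr_le0 => i _; rewrite mulr_ge0_le0 // ln_le0 //.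
by rewrite -x1 (bigD1 i) //= lerDl sumr_ge0.
Qed.

(** * Relative entropy to the maximally mixed state *)

Lemma spectral_mul P x y : P \is unitarymx ->
  (P^t* *m rdiag x *m P) *m (P^t* *m rdiag y *m P)
  = P^t* *m rdiag (\row_j (x 0 j * y 0 j)) *m P.
Proof.
move=> /unitarymxP Pu; rewrite (conj_mulmx _ _ Pu) mulmx_diag.
set a := \row_j _.
have -> // : a = map_mx (fun r => r%:C) (\row_j (x 0 j * y 0 j)).
by apply/rowP => j; rewrite !mxE rmorphM.
Qed.

Lemma trace_spectral_mul_fun (f : R -> R) P x : P \is unitarymx ->
  \tr ((P^t* *m rdiag x *m P) *m hfun f (P^t* *m rdiag x *m P))
  = (\sum_i x 0 i * f (x 0 i))%:C.
Proof.
move=> Pu; have := hfun_diag f x Pu.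
have -> : map_mx (fun r => (f r)%:C) x = map_mx (fun r => r%:C) (map_mx f x).
  by apply/rowP => j; rewrite !mxE.
move=> ->; rewrite spectral_mul // trace_spectral //; congr (_%:C).
by apply: eq_bigr => i _; rewrite !mxE.
Qed.

(** The logarithm of the maximally mixed state is the scalar [- ln m], and [w] has trace 1; what
    remains is the negative entropy of [w] shifted by [ln m]. *)
Lemma relent_max_mixed w : density w ->
  relent w (m%:R^-1)%:M
  = (complex.Re (\tr (w *m hfun (@ln R) w)) + ln m%:R)%:E.
Proof.
move=> dw; have [P [x [Pu wE x0 x1]]] := density_spectral dw.
have m0 := sum1_dim_gt0 x1.
have mC : (m%:R^-1 : C) = (m%:R^-1 : R)%:C by rewrite fmorphV rmorph_nat.
have sE : ((m%:R^-1)%:M : 'M[C]_m)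
    = (1%:M)^t* *m rdiag (const_mx (m%:R^-1)) *m 1%:M.
  rewrite mulmx1 trmx1 map_mx1 mul1mx map_const_mx diag_const_mx.
  by rewrite mC.
(* The maximally mixed state is invertible, so the support condition holds and the finite branch is
   taken. *)
rewrite /relent submx_full; last first.
  rewrite row_full_unit -scalemx1 unitmxZ ?unitmx1 // unitrV unitfE pnatr_eq0.
  by rewrite -lt0n.
congr (_%:E); rewrite mulmxBr raddfB raddfB /=; congr (_ + _).
rewrite sE hfun_diag; last by apply/unitarymxP; rewrite trmx1 map_mx1 mulmx1.
rewrite mulmx1 trmx1 map_mx1 mul1mx map_const_mx diag_const_mx lnV ?posrE ?ltr0n //.
rewrite mul_mx_scalar linearZ /=; have [_ _ ->] := dw.
by rewrite mulr1 /= opprK.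
Qed.

Lemma relent_max_mixed_le w : density w ->
  (relent w (m%:R^-1)%:M <= (ln m%:R)%:E)%E.
Proof.
move=> dw; rewrite relent_max_mixed // lee_fin gerDr.
have [P [x [Pu -> x0 x1]]] := density_spectral dw.
by rewrite trace_spectral_mul_fun //= neg_entropy_le0.
Qed.

Lemma density_conj P w : P \is unitarymx -> density w ->
  density (P *m w *m P^t*).
Proof.
move=> Pu [wh w0 w1]; split.
- apply/is_hermitianmxP; move/is_hermitianmxP: wh; rewrite expr0 !scale1r => wh.
  by rewrite !trmxC_mul trmxCK mulmxA -wh.
- move=> v; have := w0 (P^t* *m v); rewrite trmxC_mul trmxCK.
  by rewrite !mulmxA.
by rewrite mxtrace_mulC mulmxA unitarymxKV // mul1mx.
Qed.

Lemma mul_trmxC_unitary P Q :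
  P \is unitarymx -> Q \is unitarymx -> P *m Q^t* \is unitarymx.
Proof. by move=> Pu; rewrite -(trmxC_unitary Q); apply: mul_unitarymx. Qed.

(** Conjugation turns the eigenbasis [Q] into [Q *m P^t*] and keeps the eigenvalues, on which alone
    the trace depends. *)
Lemma trace_mul_fun_conj (f : R -> R) P w : P \is unitarymx ->
  w \is hermsymmx ->
  \tr ((P *m w *m P^t*) *m hfun f (P *m w *m P^t*)) = \tr (w *m hfun f w).
Proof.
move=> Pu /herm_spectral[Q [x [Qu ->]]].
have QPu := mul_trmxC_unitary Qu Pu.
have -> : P *m (Q^t* *m rdiag x *m Q) *m P^t*
    = (Q *m P^t*)^t* *m rdiag x *m (Q *m P^t*).
  by rewrite trmxC_mul trmxCK !mulmxA.
exact: etrans (trace_spectral_mul_fun f x QPu)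
  (esym (trace_spectral_mul_fun f x Qu)).
Qed.

Lemma relent_max_mixed_conj P w : P \is unitarymx -> density w ->
  relent (P *m w *m P^t*) (m%:R^-1)%:M = relent w (m%:R^-1)%:M.
Proof.
move=> Pu dw; have [wh _ _] := dw.
have trE := trace_mul_fun_conj (@ln R) Pu wh.
apply: etrans (relent_max_mixed (density_conj Pu dw)) _.
by rewrite trE relent_max_mixed.
Qed.

(** * Gibbs states and the variational principle *)

Lemma scale_rdiag (c : R) x : c%:C *: rdiag x = rdiag (c *: x).
Proof. by apply/matrixP => i j; rewrite !mxE mulrnAr rmorphM. Qed.

Lemma gibbs_spectral (beta : R) P y : (0 < m)%N -> P \is unitarymx ->
  let Z := \sum_i expR (- beta * y 0 i) in
  gibbs beta (P^t* *m rdiag y *m P)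
  = P^t* *m rdiag (\row_i (expR (- beta * y 0 i) / Z)) *m P.
Proof.
move=> m0 Pu Z; rewrite /gibbs.
have -> : (- beta)%:C *: (P^t* *m rdiag y *m P)
    = P^t* *m rdiag (- beta *: y) *m P.
  by rewrite scale_conj_mulmx scale_rdiag.
rewrite hfun_diag //.
have -> : map_mx (fun r => (expR r)%:C) (- beta *: y)
    = map_mx (fun r => r%:C) (\row_i expR (- beta * y 0 i)).
  by apply/rowP => j; rewrite !mxE.
rewrite trace_spectral // (eq_bigr (fun i => expR (- beta * y 0 i))); last first.
  by move=> i _; rewrite mxE.
rewrite -/Z scale_conj_mulmx -fmorphV scale_rdiag.
have -> // : Z^-1 *: (\row_i expR (- beta * y 0 i))
  = \row_i (expR (- beta * y 0 i) / Z).
by apply/rowP => j; rewrite !mxE mulrC.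
Qed.

Lemma gibbs_trace (beta : R) H : (0 < m)%N -> H \is hermsymmx ->
  \tr (gibbs beta H) = 1.
Proof.
move=> m0 /herm_spectral[P [y [Pu ->]]]; rewrite gibbs_spectral //.
rewrite trace_spectral // (eq_bigr (fun i => expR (- beta * y 0 i) /
  (\sum_i expR (- beta * y 0 i)))); last by move=> i _; rewrite mxE.
rewrite -mulr_suml divff // gt_eqF //.
by rewrite (bigD1 (Ordinal m0)) //= ltr_pwDl ?expR_gt0 ?sumr_ge0.
Qed.

(* The Gibbs variational principle: [w] has free energy at least that of the
   Gibbs state, and the entropy of the latter is at most [ln m]. *)
Lemma gibbs_energy_gap (beta : R) H w : H \is hermsymmx -> density w ->
  exists2 r : R, \tr (H *m (gibbs beta H - w)) = r%:C
    & ((beta * r)%:E <= relent w (m%:R^-1)%:M)%E.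
Proof.
move=> /herm_spectral[Q [y [Qu HE]]] dw.
have [P [x [Pu wE x0 x1]]] := density_spectral dw.
have m0 := sum1_dim_gt0 x1.
set Z := \sum_i expR (- beta * y 0 i).
have Z0 : 0 < Z.
  by rewrite /Z (bigD1 (Ordinal m0)) //= ltr_pwDl ?expR_gt0 ?sumr_ge0.
(* The Boltzmann weights, that is, the eigenvalues of the Gibbs state. Their logarithms are affine
   in the energies. *)
pose g := (\row_i (expR (- beta * y 0 i) / Z)) : 'rV[R]_m.
have g0 i : 0 < g 0 i by rewrite mxE divr_gt0 ?expR_gt0.
have g1 : \sum_i g 0 i = 1.
  rewrite -[RHS](divff (lt0r_neq0 Z0)) mulr_suml.
  by apply: eq_bigr => i _; rewrite mxE.
have lng i : ln (g 0 i) = - beta * y 0 i - ln Z.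
  by rewrite mxE ln_div ?posrE ?expR_gt0 // expRK.
have WuP := mul_trmxC_unitary Pu Qu.
set W := P *m Q^t* in WuP.
rewrite relent_max_mixed //.
have -> : \tr (w *m hfun (@ln R) w) = (\sum_i x 0 i * ln (x 0 i))%:C.
  by rewrite wE; apply: trace_spectral_mul_fun.
exists (\sum_i g 0 i * y 0 i
    - \sum_i \sum_j normc (W i j) ^+ 2 * (x 0 i * y 0 j)).
  rewrite mulmxBr raddfB /= rmorphB /=; congr (_ - _).
    rewrite HE mxtrace_mulC gibbs_spectral // -/Z -/g.
    rewrite spectral_mul // trace_spectral //; congr (_%:C).
    by apply: eq_bigr => i _; rewrite [LHS]mxE.
  by rewrite mxtrace_mulC HE wE trace_spectral_mul.
rewrite lee_fin /=.
(* [K] bounds the entropy of the Gibbs state by [ln m]; [L] below is Klein's inequality for [w]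
   against the Gibbs state. Once both are expressed through energies, [ln Z] cancels in their
   sum. *)
have K : - ln m%:R <= \sum_i g 0 i * ln (g 0 i).
  by apply: neg_entropy_ge => // i; apply: ltW.
have := klein WuP x0 g0; rewrite x1 g1 => /(_ erefl) L.
have gE : \sum_i g 0 i * ln (g 0 i) = - (beta * \sum_i g 0 i * y 0 i) - ln Z.
  rewrite -[ln Z]mul1r -g1 mulr_suml mulr_sumr -sumrN -sumrB.
  by apply: eq_bigr => i _; rewrite lng mulrBr mulrCA mulNr.
have xE : \sum_i \sum_j normc (W i j) ^+ 2 * (x 0 i * ln (g 0 j))
    = - (beta * \sum_i \sum_j normc (W i j) ^+ 2 * (x 0 i * y 0 j)) - ln Z.
  rewrite -[ln Z]mul1r -x1 mulr_suml mulr_sumr -sumrN -sumrB.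
  apply: eq_bigr => i _.
  have -> : x 0 i * ln Z = \sum_j normc (W i j) ^+ 2 * (x 0 i * ln Z).
    by rewrite -mulr_suml unitary_row_sum // mul1r.
  rewrite mulr_sumr -sumrN -sumrB; apply: eq_bigr => j _; rewrite lng.
  by ring.
rewrite gE in K; rewrite xE in L.
rewrite mulrBr.
by lra.
Qed.

End Entropy.

(** * Channels: Kraus forms, trace preservation and iterated contraction *)

Section Channels.
Variable R : realType.
Local Notation C := R[i].

Lemma lee_contractionS (q : R) (k : nat) (x y z : \bar R) : 0 <= q ->
  (y <= q%:E * z)%E -> (x <= (q ^+ k)%:E * y)%E ->
  (x <= (q ^+ k.+1)%:E * z)%E.
Proof.
move=> q0 yz /le_trans; apply; rewrite exprSr EFinM -muleA.
by apply: lee_wpmul2l; rewrite // lee_fin exprn_ge0.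
Qed.

Lemma density_kraus_sum (m : nat) (A : finType) (K : A -> 'M[C]_m) (w : 'M[C]_m) :
  density w -> \tr (\sum_a K a *m w *m (K a)^t*) = 1 ->
  density (\sum_a K a *m w *m (K a)^t*).
Proof.
move=> [wh w0 _] w1; split; [| move=> v | exact: w1].
  apply/is_hermitianmxP; move/is_hermitianmxP: wh; rewrite expr0 !scale1r => wh.
  rewrite raddf_sum /= raddf_sum /=; apply: eq_bigr => a _.
  by rewrite !trmxC_mul trmxCK mulmxA -wh.
rewrite mulmx_sumr mulmx_suml summxE; apply: sumr_ge0 => a _.
by have := w0 ((K a)^t* *m v); rewrite trmxC_mul trmxCK !mulmxA.
Qed.

Variable V : finType.

(** Expanding the product over qubits of the one-qubit Kraus sums gives one term for each choice [f]
    of a Kraus operator per qubit. This reduces positivity of the tensor power to a one-qubit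
    computation. *)
Lemma tensor_channel_kraus (A : finType) (K : A -> 'M[C]_2)
    (E : 'M[C]_2 -> 'M[C]_2) (w : 'M[C]_(qdim V)) :
  (forall i j r s, E (delta_mx i j) r s = \sum_a K a r i * (K a s j)^*%R) ->
  tensor_channel E w
  = \sum_(f : {ffun V -> A})
      tensor (fun k => K (f k)) *m w *m (tensor (fun k => K (f k)))^t*.
Proof.
move=> EK; apply/matrixP => r s; rewrite /tensor_channel !summxE.
under [RHS]eq_bigr => f _.
  rewrite -mulmxA mxE.
  under eq_bigr => i _.
    rewrite [X in _ * X]mxE big_distrr /=.
    over.
  over.
rewrite [RHS]exchange_big /=; apply: eq_bigr => i _.
rewrite summxE [RHS]exchange_big /=; apply: eq_bigr => j _.
rewrite !mxE; under eq_bigr => k _ do rewrite EK.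
rewrite bigA_distr_bigA big_distrr /=; apply: eq_bigr => f _.
by rewrite !mxE rmorph_prod big_split /= mulrCA.
Qed.

Lemma sum_bits (F : {ffun V -> 'I_2} -> C) :
  \sum_i F (bits i) = \sum_b F b.
Proof.
rewrite (reindex enum_rank); last exact/onW_bij/enum_rank_bij.
by apply: eq_bigr => b _; rewrite /bits enum_rankK.
Qed.

Lemma tensor_trace (A : V -> 'M[C]_2) : \tr (tensor A) = \prod_k \tr (A k).
Proof.
rewrite /mxtrace bigA_distr_bigA -sum_bits; apply: eq_bigr => i _.
by rewrite mxE.
Qed.

Lemma tensor_channel_trace (E : 'M[C]_2 -> 'M[C]_2) (w : 'M[C]_(qdim V)) :
  (forall i j, \tr (E (delta_mx i j)) = (i == j)%:R) ->
  \tr (tensor_channel E w) = \tr w.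
Proof.
move=> Etr; rewrite /tensor_channel raddf_sum; apply: eq_bigr => i _ /=.
rewrite raddf_sum (bigD1 i) //= big1 ?addr0 => [|j ji].
  rewrite linearZ /= tensor_trace big1 ?mulr1 // => k _.
  by rewrite Etr eqxx.
rewrite linearZ /= tensor_trace.
(* Off the diagonal the two bit strings differ at some qubit [k], whose factor has trace 0. *)
have [k ijk] : exists k, bits i k != bits j k.
  apply/existsP; apply: contraNT ji; rewrite negb_exists => /forallP ij.
  apply/eqP/enum_val_inj/ffunP => k; apply/eqP.
  by rewrite eq_sym; have := ij k; rewrite negbK.
by rewrite (bigD1 k) //= Etr (negPf ijk) mul0r mulr0.
Qed.

Lemma mxtrace_delta (m : nat) (i j : 'I_m) :
  \tr (delta_mx i j : 'M[C]_m) = (i == j)%:R.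
Proof.
rewrite /mxtrace (bigD1 i) //= mxE eqxx /= big1 ?addr0 // => k /negPf ki.
by rewrite mxE ki.
Qed.

Lemma depolarizing1_trace (p : R) i j :
  \tr (depolarizing1 p (delta_mx i j)) = (i == j)%:R :> C.
Proof.
rewrite /depolarizing1 raddfD /= linearZ linearZ /= mxtrace_delta mxtrace_scalar.
rewrite -[2^-1 *+ 2]mulr_natr mulVf ?pnatr_eq0 // mulr1 -mulrDl -rmorphD subrK.
by rewrite mul1r.
Qed.

(** Matrix units replace the usual Pauli operators: the sum of [|b><c| w |c><b|] over all [b], [c]
    is [tr w] times the identity, so the weight [p / 2] yields the fully mixing term. *)
Definition depolarizing1_kraus (p : R) (a : 'I_1 + 'I_2 * 'I_2) : 'M[C]_2 :=
  match a with
  | inl _ => (Num.sqrt (1 - p))%:C%:M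
  | inr bc => (Num.sqrt (p / 2))%:C *: delta_mx bc.1 bc.2
  end.

Lemma depolarizing1_krausE (p : R) i j r s : 0 < p <= 1 ->
  depolarizing1 p (delta_mx i j) r s
  = \sum_a depolarizing1_kraus p a r i * (depolarizing1_kraus p a s j)^*%R.
Proof.
move=> /andP[p0 p1].
have realK (x : R) : Num.conj x%:C = x%:C.
  by apply/CrealP; rewrite complex_real.
have sqrtK (x : R) : 0 <= x -> (Num.sqrt x)%:C * (Num.sqrt x)%:C = x%:C.
  by move=> x0; rewrite -rmorphM -expr2 sqr_sqrtr.
rewrite big_sumType big_ord1 /= -(pair_bigA _ (fun a b : 'I_2 =>
  ((Num.sqrt (p / 2))%:C *: delta_mx a b) r i
    * (((Num.sqrt (p / 2))%:C *: delta_mx a b) s j)^*%R)) /=.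
rewrite /depolarizing1 !mxE rmorphMn /= realK; congr (_ + _).
  rewrite -[(1 - p)%:C]sqrtK ?subr_ge0 //.
  by case: (r == i); case: (s == j); rewrite ?mulr0n ?mulr1n ?mulr0 ?mul0r ?mulr1.
(* Among the matrix units only the one at [(r, i)] contributes. *)
rewrite (bigD1 r) //= [X in _ + X]big1 ?addr0 => [|a ar]; last first.
  by rewrite big1 // => b _; rewrite !mxE [r == a]eq_sym (negPf ar) mulr0 mul0r.
rewrite (bigD1 i) //= [X in _ + X]big1 ?addr0 => [|b bi]; last first.
  by rewrite !mxE [i == b]eq_sym (negPf bi) andbF mulr0 mul0r.
rewrite !mxE !eqxx mulr1 rmorphM /= realK mulrA sqrtK ?divr_ge0 // ?ltW //.
rewrite mxtrace_delta rmorph_nat rmorphM fmorphV rmorph_nat /= -2!mulrA.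
congr (_ * _); rewrite [s == r]eq_sym [j == i]eq_sym.
by case: (r == s); case: (i == j);
  rewrite ?mulr0n ?mulr1n ?mulr0 ?mul0r ?mulr1 ?mul1r.
Qed.

Lemma density_depolarizing (p : R) (w : 'M[C]_(qdim V)) :
  0 < p <= 1 -> density w -> density (depolarizing p w).
Proof.
move=> p01 dw; have [_ _ w1] := dw.
have trw := tensor_channel_trace w (depolarizing1_trace p).
have wE := tensor_channel_kraus w
  (fun i j r s => depolarizing1_krausE i j r s p01).
rewrite /depolarizing wE; apply: density_kraus_sum => //.
by rewrite -wE trw.
Qed.

(** Both conclusions are proved in one induction, because the contraction estimate is available for
    states only. The first layer is peeled off, so the input state must vary. *)
Lemma circuit_relent (p : R) (Us : seq 'M[C]_(qdim V)) (rho : 'M[C]_(qdim V)) :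
  0 < p <= 1 ->
  (forall w : 'M[C]_(qdim V), density w ->
     (relent (depolarizing p w) (max_mixed R V)
        <= ((1 - p) ^+ 2)%:E * relent w (max_mixed R V))%E) ->
  {in Us, forall U, U \is unitarymx} -> density rho ->
  density (circuit p Us rho) /\
  (relent (circuit p Us rho) (max_mixed R V)
     <= (((1 - p) ^+ 2) ^+ size Us)%:E * relent rho (max_mixed R V))%E.
Proof.
move=> p01 contr; elim: Us rho => [|U Us IH] rho Uu drho.
  by rewrite expr0 mul1e.
have Uu' : U \is unitarymx by apply: Uu; rewrite mem_head.
have dU := density_conj Uu' drho.
have [||dout le_out] := IH (depolarizing p (U *m rho *m U^t*)).
- by move=> W WUs; apply: Uu; rewrite in_cons WUs orbT.
- exact: density_depolarizing.
split; first exact: dout.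
have relE : relent (U *m rho *m U^t*) (max_mixed R V)
    = relent rho (max_mixed R V) := relent_max_mixed_conj Uu' drho.
have := contr _ dU; rewrite relE => leU.
exact: (lee_contractionS (sqr_ge0 _) leU le_out).
Qed.

(** * Local Hamiltonians and the depth condition *)

Lemma acts_on_empty (S : {set V}) (h : 'M[C]_(qdim V)) :
  S =i pred0 -> acts_on S h -> exists c, h = c%:M.
Proof.
move=> S0 [B ->].
(* A register without qubits has the single basis state [x0], so [B] has one entry. Agreement on all
   qubits outside [S] then means [i = j]. *)
pose x0 : 'I_(qdim {k : V | k \in S}) := enum_rank [ffun=> ord0].
exists (B x0 x0).
have restrE x : enum_rank (@restrict_bits V S x) = x0.
  by congr enum_rank; apply/ffunP => -[k kin]; exfalso; rewrite S0 in kin.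
apply/matrixP => i j; rewrite !mxE !restrE; congr (_ *+ nat_of_bool _).
apply/forallP/eqP => [ij|-> k]; last by rewrite eqxx implybT.
apply/enum_val_inj/ffunP => k; apply/eqP.
by have := ij k; rewrite S0.
Qed.

End Channels.

Lemma local_hamiltonian_herm (R : realType) (n d kappa : nat)
    (pos : 'I_n -> 'rV[int]_d) (J : R) H :
  local_hamiltonian pos kappa J H -> H \is hermsymmx.
Proof.
case=> N [h [-> hP]]; apply/is_hermitianmxP; rewrite expr0 scale1r.
rewrite raddf_sum /= raddf_sum /=; apply: eq_bigr => a _.
by have [/is_hermitianmxP + _ _] := hP a; rewrite expr0 scale1r.
Qed.

Lemma local_hamiltonian0_scalar (R : realType) (n d : nat)
    (pos : 'I_n -> 'rV[int]_d) (J : R) H :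
  local_hamiltonian pos 0 J H -> exists c, H = c%:M.
Proof.
case=> N [h [-> hP]].
have hc a : exists c, h a = c%:M.
  have [_ [S + hS] _] := hP a; rewrite leqn0 cardfs_eq0 => /eqP S0.
  by apply: acts_on_empty hS => k; rewrite inE S0.
have [c cP] := choice hc; exists (\sum_a c a).
by rewrite raddf_sum; apply: eq_bigr.
Qed.

(** From [1 - p <= exp (- p)] the rate is at most [exp (- 2 p D)], and the depth condition says that
    [2 p D >= ln A]. *)
Lemma contraction_rate_le (R : realType) (p A : R) (D : nat) :
  0 < p <= 1 -> 0 < A -> ln A / (2 * p) <= D%:R ->
  ((1 - p) ^+ 2) ^+ D <= A^-1.
Proof.
move=> /andP[p0 p1] A0 leD.
have leE : (1 - p) ^+ 2 <= expR (- (2 * p)).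
  have -> : - (2 * p) = 2%:R * - p by rewrite mulrN.
  rewrite expRM_natl lerXn2r ?nnegrE ?subr_ge0 ?expR_ge0 //.
  exact: expR_ge1Dx.
apply: (@le_trans _ _ (expR (- (2 * p)) ^+ D)).
  by rewrite lerXn2r ?nnegrE ?expR_ge0 ?sqr_ge0.
rewrite -expRM_natr -[A^-1]lnK ?posrE ?invr_gt0 // ler_expR lnV ?posrE //.
by rewrite mulNr lerN2 mulrC -ler_pdivrMr // mulr_gt0.
Qed.

(** * The energy estimate at the largest admissible inverse temperature *)

Theorem proposition3 (R : realType) (n d kappa D : nat) (J p eps : R)
    (pos : 'I_n -> 'rV[int]_d) (H rho : 'M[R[i]]_(qdim 'I_n))
    (Us : D.-tuple 'M[R[i]]_(qdim 'I_n)) :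
  (0 < d)%N -> injective pos ->
  0 < J -> local_hamiltonian pos kappa J H ->
  kappa%:R * J * n%:R <= opnorm H <= 2 * kappa%:R * J * n%:R ->
  0 < p <= 1 -> 0 < eps ->
  (forall w : 'M[R[i]]_(qdim 'I_n), density w ->
     (relent (depolarizing p w) (max_mixed R 'I_n)
        <= ((1 - p) ^+ 2)%:E * relent w (max_mixed R 'I_n))%E) ->
  (forall t : 'I_D, tnth Us t \is unitarymx) ->
  density rho ->
  ln (20 * expR 1 * d%:R ^+ kappa * eps^-1) / (2 * p) <= D%:R ->
  exists beta : R,
    [/\ 0 <= beta,
        \tr (H *m (gibbs beta H - circuit p Us rho))
          <= (2 * kappa%:R * J * n%:R * eps)%:C
      & beta <= (5 * expR 1 * kappa%:R * d%:R ^+ kappa * J)^-1].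
Proof.
move=> d0 _ J0 Hloc _ p01 eps0 contr Uu drho leD.
have Hh := local_hamiltonian_herm Hloc.
have N0 : (0 < qdim 'I_n)%N by rewrite qdimE expn_gt0.
have Uin : {in tval Us, forall U, U \is unitarymx}.
  by move=> U /(tnthP Us)[t ->].
have [dw le_w] := circuit_relent p01 contr Uin drho.
case: (posnP kappa) => [k0|k0].
  move: Hloc; rewrite k0 => /local_hamiltonian0_scalar[c cE].
  (* Here the bound on [beta] reads [0 <= 0], since the inverse of 0 is 0. The energy gap of a
     scalar [H] vanishes because both states have trace 1. *)
  exists 0; split=> //; last first.
    by rewrite mulr0 !mul0r invr0.
  rewrite mulr0 !mul0r cE mul_scalar_mx linearZ /= raddfB /= -cE.
  rewrite gibbs_trace //; have [_ _ ->] := dw.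
  by rewrite subrr mulr0.
set B := 5 * expR 1 * kappa%:R * d%:R ^+ kappa * J.
have dk0 : 0 < d%:R ^+ kappa :> R by rewrite exprn_gt0 // ltr0n.
have B0 : 0 < B by rewrite /B !mulr_gt0 ?expR_gt0 ?ltr0n.
exists B^-1; split; [by rewrite invr_ge0 ltW | | by []].
have [r -> le_r] := gibbs_energy_gap B^-1 Hh dw; rewrite lecR.
set A := 20 * expR 1 * d%:R ^+ kappa * eps^-1 in leD.
have A0 : 0 < A by rewrite /A !mulr_gt0 ?expR_gt0 ?invr_gt0.
have rate := contraction_rate_le p01 A0 leD.
(* With [ln 2 <= 1] the initial relative entropy, at most [n * ln 2], is bounded by [n]. *)
have ln2 : ln 2 <= 1 :> R by have := @le_ln1Dx R 1; apply; lra.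
have lnN : ln (qdim 'I_n)%:R <= n%:R :> R.
  by rewrite qdimE natrX lnXn // -[leLHS]mulr_natl ler_piMr.
have lnN0 : 0 <= ln (qdim 'I_n)%:R :> R by rewrite ln_ge0 // ler1n.
have q0 : 0 <= ((1 - p) ^+ 2) ^+ D by rewrite exprn_ge0 // sqr_ge0.
have : B^-1 * r <= A^-1 * n%:R.
  rewrite -lee_fin; apply: le_trans le_r _; apply: le_trans le_w _.
  have le_rho := relent_max_mixed_le drho.
  rewrite size_tuple; apply: le_trans (lee_wpmul2l _ le_rho) _.
    by rewrite lee_fin.
  by rewrite -EFinM lee_fin ler_pM.
rewrite ler_pdivrMl // => /le_trans; apply.
(* The factors [e] and [d^kappa] cancel and 5/20 leaves 1/4, well within the allowed factor 2. *)
have -> : B * (A^-1 * n%:R) = kappa%:R * J * n%:R * eps / 4.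
  by rewrite /A /B; field; rewrite ?gt_eqF ?expR_gt0.
have : 0 <= kappa%:R * J * n%:R * eps by rewrite !mulr_ge0 // ltW.
lra.
Qed.
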